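(* Let $A$ be a commutative ring, let $k\ge 1$, let $\vec s=(n_1,\dots,n_k)$ be a tuple of positive integers, and let $X_\bullet=X_\bullet(\vec s;A)$ be the diagonal simplicial tensor module. For every $p\ge 1$ and every $0\le j\le p$, the horn kernel $R_{p,j}=\bigcap_{i\in[p]\setminus\{j\}}\ker(d_i^p:X_p\to X_{p-1})$ is non-trivial, i.e. $R_{p,j}\neq\{0\}$, if and only if $k\ge p$.
   Context: Notation: $[p]=\{0,\dots,p\}$. A shape is a tuple $\vec s=(n_1,\dots,n_k)$ of positive integers, $k\ge 1$; put $n=\min(n_1,\dots,n_k)-1$, $M_a(p)=n_a-1-n+p$ (so $M_a(p)\ge p$) and $I_p=\prod_{a=1}^k[M_a(p)]$ for $p\ge 0$. Let $\delta_i^q:[q-1]\to[q]$ be the increasing injection missing $i$ and $\sigma_i^q:[q+1]\to[q]$ the nondecreasing surjection taking the value $i$ twice. Define $\Delta_i^p=\prod_{a=1}^k\delta_i^{M_a(p)}:I_{p-1}\to I_p$ ($p\ge1$, $0\le i\le p$) and $\Sigma_i^p=\prod_{a=1}^k\sigma_i^{M_a(p)}:I_{p+1}\to I_p$ ($p\ge 0$, $0\le i\le p$). The diagonal simplicial tensor module $X_\bullet(\vec s;A)$ is the simplicial $A$-module with $X_p=A^{I_p}$ (all functions $T:I_p\to A$), faces $d_i^p(T)=T\circ\Delta_i^p$ and degeneracies $s_i^p(T)=T\circ\Sigma_i^p$.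
   Formalization: The commutative ring A is assumed to be nonzero; over the zero ring every X_p is zero, so the horn kernel is trivial even when k ≥ p and the claim fails. *)

(* Defs.v *)
From HB Require Import structures.
From mathcomp Require Import all_boot all_order all_algebra.
From mathcomp Require Import zify.

Set Implicit Arguments.
Unset Strict Implicit.
Unset Printing Implicit Defensive.

Import GRing.Theory.
Local Open Scope ring_scope.

(* Throughout, [p] = {0, ..., p} is the ordinal type 'I_p.+1. *)

(* [face] at p is the family d_i^{p+1} : X_{p+1} -> X_p (0 <= i <= p+1), so
   that no predecessor p-1 is needed; [degen] at p is s_i^p : X_p -> X_{p+1}. *)
Record simplicialModule (A : nzRingType) := SimplicialModule {
  obj :> nat -> lmodType A;
  face : forall p, 'I_p.+2 -> {linear obj p.+1 -> obj p};
  degen : forall p, 'I_p.+1 -> {linear obj p -> obj p.+1};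
  face_face : forall p i j (x : obj p.+2), (i < j <= p.+2)%N ->
    face (inord i) (face (inord j) x) = face (inord j.-1) (face (inord i) x);
  face_degen_lt : forall p i j (x : obj p.+1), (i < j <= p.+1)%N ->
    face (inord i) (degen (inord j) x) = degen (inord j.-1) (face (inord i) x);
  face_degen_eq : forall p i (x : obj p), (i <= p)%N ->
    face (inord i) (degen (inord i) x) = x;
  face_degen_succ : forall p i (x : obj p), (i <= p)%N ->
    face (inord i.+1) (degen (inord i) x) = x;
  face_degen_gt : forall p i j (x : obj p.+1), (j.+1 < i <= p.+2)%N ->
    face (inord i) (degen (inord j) x) = degen (inord j) (face (inord i.-1) x);
  degen_degen : forall p i j (x : obj p), (i <= j <= p)%N ->
    degen (inord i) (degen (inord j) x)
    = degen (inord j.+1) (degen (inord i) x)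
}.

Definition horn_kernel (A : nzRingType) (X : simplicialModule A) (p : nat)
    (j : 'I_p.+2) : {pred X p.+1} :=
  [pred x | [forall i : 'I_p.+2, (i != j) ==> (face X i x == 0)]].

Definition delta (q : nat) (i : 'I_q.+2) (m : 'I_q.+1) : 'I_q.+2 := lift i m.

Lemma sigma_subproof (q : nat) (i : 'I_q.+1) (m : 'I_q.+2) :
  (unbump i m < q.+1)%N.
Proof. by rewrite /unbump; have := ltn_ord i; have := ltn_ord m; lia. Qed.

(* unbump i m is m.-1 if i < m, and m otherwise. *)
Definition sigma (q : nat) (i : 'I_q.+1) (m : 'I_q.+2) : 'I_q.+1 :=
  Ordinal (sigma_subproof i m).

Section Diagonal.
Variables (k : nat) (s : k.-tuple nat).

(* The head of s serves only as a starting value: for k >= 1 it belongs to s,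
   hence this is the minimum of s, minus one. *)
Definition shape_dim : nat := (\big[minn/head 0 s]_(m <- s) m).-1.

(* For positive entries no subtraction truncates. The summand p comes first so
   that M p.+1 a is convertible to (M p a).+1. *)
Definition M (p : nat) (a : 'I_k) : nat := (p + ((tnth s a).-1 - shape_dim))%N.

Definition idx (p : nat) : finType := {dffun forall a : 'I_k, 'I_(M p a).+1}.

Definition widenM (p : nat) (a : 'I_k) (i : 'I_p.+1) : 'I_(M p a).+1 :=
  widen_ord (leq_addr ((tnth s a).-1 - shape_dim) p.+1) i.

Definition Delta (p : nat) (i : 'I_p.+2) (m : idx p) : idx p.+1 :=
  [ffun a => delta (widenM a i) (m a) : 'I_(M p.+1 a).+1].

Definition Sigma (p : nat) (i : 'I_p.+1) (m : idx p.+1) : idx p :=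
  [ffun a => sigma (widenM a i) (m a)].

Section Module.
(* A is nonzero: over the zero ring every X_p is the zero module. *)
Variable A : comNzRingType.

Definition tensors (p : nat) : lmodType A := {ffun idx p -> A^o}.

Definition diag_face (p : nat) (i : 'I_p.+2) (T : tensors p.+1) : tensors p :=
  [ffun m => T (Delta i m)].

Definition diag_degen (p : nat) (i : 'I_p.+1) (T : tensors p) : tensors p.+1 :=
  [ffun m => T (Sigma i m)].

Lemma diag_face_linear p (i : 'I_p.+2) : linear (diag_face i).
Proof. by move=> c T U; apply/ffunP=> m; rewrite !ffunE. Qed.

Lemma diag_degen_linear p (i : 'I_p.+1) : linear (diag_degen i).
Proof. by move=> c T U; apply/ffunP=> m; rewrite !ffunE. Qed.

HB.instance Definition _ p (i : 'I_p.+2) :=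
  GRing.isLinear.Build A (tensors p.+1) (tensors p) *:%R (diag_face i)
    (diag_face_linear i).

HB.instance Definition _ p (i : 'I_p.+1) :=
  GRing.isLinear.Build A (tensors p) (tensors p.+1) *:%R (diag_degen i)
    (diag_degen_linear i).

Local Ltac simplicial_identity :=
  move=> *; apply/ffunP=> m; rewrite !ffunE;
  match goal with |- fun_of_fin ?T _ = fun_of_fin ?T _ => apply: (congr1 T) end;
  apply/ffunP=> a; rewrite !ffunE; apply: val_inj;
  rewrite /= !inordK /bump /unbump;
  try match goal with |- context [nat_of_ord (_ _)] =>
    move: (nat_of_ord _) => y end; lia.

Lemma diag_face_face p i j (x : tensors p.+2) : (i < j <= p.+2)%N ->
  diag_face (inord i) (diag_face (inord j) x)
  = diag_face (inord j.-1) (diag_face (inord i) x).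
Proof. simplicial_identity. Qed.

Lemma diag_face_degen_lt p i j (x : tensors p.+1) : (i < j <= p.+1)%N ->
  diag_face (inord i) (diag_degen (inord j) x)
  = diag_degen (inord j.-1) (diag_face (inord i) x).
Proof. simplicial_identity. Qed.

Lemma diag_face_degen_eq p i (x : tensors p) : (i <= p)%N ->
  diag_face (inord i) (diag_degen (inord i) x) = x.
Proof. simplicial_identity. Qed.

Lemma diag_face_degen_succ p i (x : tensors p) : (i <= p)%N ->
  diag_face (inord i.+1) (diag_degen (inord i) x) = x.
Proof. simplicial_identity. Qed.

Lemma diag_face_degen_gt p i j (x : tensors p.+1) : (j.+1 < i <= p.+2)%N ->
  diag_face (inord i) (diag_degen (inord j) x)
  = diag_degen (inord j) (diag_face (inord i.-1) x).
Proof. simplicial_identity. Qed.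

Lemma diag_degen_degen p i j (x : tensors p) : (i <= j <= p)%N ->
  diag_degen (inord i) (diag_degen (inord j) x)
  = diag_degen (inord j.+1) (diag_degen (inord i) x).
Proof. simplicial_identity. Qed.

Definition diag_tensor : simplicialModule A :=
  @SimplicialModule A tensors
    (fun p i => diag_face i : {linear _ -> _})
    (fun p i => diag_degen i : {linear _ -> _})
    diag_face_face
    diag_face_degen_lt
    diag_face_degen_eq
    diag_face_degen_succ
    diag_face_degen_gt
    diag_degen_degen.

End Module.
End Diagonal.

(* Main.v *)
(** In degree [p.+1], a tensor lies in the horn kernel iff it vanishes on the
    images of all [Delta i] with [i != j], and a multi-index lies outside the
    image of [Delta i] iff one of its [k] entries equals [i]. So the horn kernel
    is nonzero iff some multi-index takes all of the [p.+1] values [i != j];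
    such a multi-index exists iff it has at least [p.+1] entries. *)
Require Import Defs.
From mathcomp Require Import all_boot all_order all_algebra.

Import GRing.Theory.
Local Open Scope ring_scope.

Lemma Delta_neq (k : nat) (s : k.-tuple nat) (p : nat) (i : 'I_p.+2)
    (m : idx s p) (a : 'I_k) :
  Delta i m a != widenM s a i.
Proof. by rewrite ffunE eq_sym; exact: neq_lift. Qed.

(** [Delta i] acts entrywise, so preimages under [delta] can be chosen one entry at a time. *)
Lemma DeltaP (k : nat) (s : k.-tuple nat) (p : nat) (i : 'I_p.+2)
    (m : idx s p.+1) :
  (forall a, m a != widenM s a i) -> exists m' : idx s p, m = Delta i m'.
Proof.
move=> m_neq_i.
have lift_m a : {b : 'I_(M s p a).+1 | m a = delta (widenM s a i) b}.
  have := m_neq_i a; rewrite eq_sym => /unlift_some[b mab _].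
  by exists b.
exists [ffun a => sval (lift_m a)]; apply/ffunP=> a.
by rewrite !ffunE; exact: (svalP (lift_m a)).
Qed.

Lemma horn_kernelP (A : comNzRingType) (k : nat) (s : k.-tuple nat) (p : nat)
    (j : 'I_p.+2) (T : tensors s A p.+1) :
  reflect (forall i, i != j -> forall m : idx s p, T (Delta i m) = 0)
          (T \in horn_kernel (X := diag_tensor s A) j).
Proof.
apply: (iffP forallP) => [T0 i ij m|T0 i].
  have /implyP/(_ ij)/eqP/ffunP/(_ m) := T0 i.
  by rewrite !ffunE.
by apply/implyP=> ij; apply/eqP/ffunP=> m; rewrite !ffunE T0.
Qed.

Lemma horn_kernel_eq0 (A : comNzRingType) (k : nat) (s : k.-tuple nat)
    (p : nat) (j : 'I_p.+2) :
  (k <= p)%N -> horn_kernel (X := diag_tensor s A) j =i pred1 0.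
Proof.
move=> le_kp T; rewrite [RHS]inE; apply/idP/eqP => [/horn_kernelP T0|->].
  apply/ffunP=> m; rewrite [RHS]ffunE.
  (* [lift j] enumerates the face indices other than [j]; either [m] misses one of them or it takes
     them all. *)
  have [/existsP[i /forallP mi]|] :=
      boolP [exists i, [forall a, m a != widenM s a (lift j i)]].
    by have [m' ->] := DeltaP _ _ _ _ _ mi; rewrite T0 // eq_sym neq_lift.
  rewrite negb_exists => /forallP m_onto.
  have pick_a i : {a | m a == widenM s a (lift j i)}.
    apply: sigW; have := m_onto i; rewrite negb_forall => /existsP[a].
    by rewrite negbK; exists a.
  (* An entry has only one value, so the [p.+1] values need distinct positions among [k]. *)
  have inj_a : injective (fun i => sval (pick_a i)).
    move=> i1 i2 eq_a; apply: (@lift_inj _ j); apply: val_inj => /=.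
    have := svalP (pick_a i2); rewrite -eq_a (eqP (svalP (pick_a i1))).
    by move/eqP/(congr1 val).
  by have := leq_card _ inj_a; rewrite !card_ord leqNgt ltnS le_kp.
by apply/horn_kernelP=> i _ m; rewrite ffunE.
Qed.

Lemma horn_kernel_neq0 (A : comNzRingType) (k : nat) (s : k.-tuple nat)
    (p : nat) (j : 'I_p.+2) :
  (p < k)%N ->
  exists2 T : tensors s A p.+1,
    T \in horn_kernel (X := diag_tensor s A) j & T != 0.
Proof.
move=> lt_pk.
(* The first [p.+1] entries run through the values other than [j]; [minn] makes later entries repeat
   the last one. *)
pose m : idx s p.+1 :=
  [ffun a : 'I_k => widenM s a (lift j (inord (minn a p)))].
(* The indicator of [m] is nonzero since [1 != 0] in [A]. *)
exists [ffun m' => (m' == m)%:R]; last first.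
  apply/eqP=> /ffunP/(_ m)/eqP.
  by rewrite !ffunE eqxx oner_eq0.
apply/horn_kernelP=> i; rewrite eq_sym => /unlift_some[i0 -> _] m'.
rewrite ffunE; case: eqP => // eq_m.
have lt_i0k : (i0 < k)%N by exact: leq_trans (ltn_ord i0) lt_pk.
(* Entry [i0] of [m] is [lift j i0], a value that [Delta (lift j i0)] omits. *)
have /eqP[] := Delta_neq _ s _ (lift j i0) m' (Ordinal lt_i0k).
rewrite eq_m ffunE; congr (widenM s _ (lift j _)).
apply: val_inj; rewrite /= (minn_idPl _) ?inordK //; exact: (ltn_ord i0).
Qed.

Theorem corollary3p9 (A : comNzRingType) (k : nat) (hk : (1 <= k)%N)
    (s : k.-tuple nat) (hs : forall a : 'I_k, (0 < tnth s a)%N)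
    (p : nat) (j : 'I_p.+2) :
  ~ (@horn_kernel A (diag_tensor s A) p j =i pred1 0) <-> (p.+1 <= k)%N.
Proof.
split=> [nz|lt_pk].
  by rewrite ltnNge; apply/negP=> /(horn_kernel_eq0 A k s p j).
have [T T_ker T_neq0] := horn_kernel_neq0 A k s p j lt_pk.
by move=> /(_ T); rewrite T_ker [RHS]inE (negPf T_neq0).
Qed.
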